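(* Assume there is $M>0$ with $|\log\hat\pi_k(x)|\le M$ for all $x\in\mathcal X$ and all $k\in[1,p]$. For each $k$ let $S_k=(x^k_1,\dots,x^k_{m_k})$ be drawn i.i.d. from $\mathsf p_k$, the samples $S_1,\dots,S_p$ being independent, and let $\hat{\mathsf p}_k$ be the empirical distribution of $S_k$. Then for any $\delta\in(0,1)$, with probability at least $1-\delta$, simultaneously for all $g\in\mathcal G_1$ and all $\lambda\in\Delta$, $$\mathbb E_{x\sim\mathsf p_\lambda}[-\log\pi_g(x)]\le\mathbb E_{x\sim\hat{\mathsf p}_\lambda}[-\log\pi_g(x)]+\sum_{k=1}^p\lambda_k\Big[2\sqrt2\,C_\Pi\,e^{M}\,\mathfrak R^k_{m_k}(\mathcal G_1)+M\sqrt{\frac{\log(p/\delta)}{2m_k}}\Big].$$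
   Context: Fix an integer $p\ge1$, $[1,p]=\{1,\dots,p\}$, $\Delta=\{\lambda\in\mathbb R^p:\lambda_k\ge0,\ \sum_k\lambda_k=1\}$. Let $\mathcal X$ be a countable set, $\mathsf p_1,\dots,\mathsf p_p$ probability distributions on $\mathcal X$, and $\hat\pi_1,\dots,\hat\pi_p$ probability distributions on $\mathcal X$ (experts). A gate is $g:\mathcal X\times[1,p]\to[0,1]$ with $\sum_kg(x,k)=1$ for each $x$; $\pi_g(x)=\sum_kg(x,k)\hat\pi_k(x)$, and $\mathcal G_1$ is the set of gates with $\sum_{x\in\mathcal X}\pi_g(x)=1$. Each $g$ is viewed as the vector-valued function $x\mapsto(g(x,1),\dots,g(x,p))\in\mathbb R^p$. For $\lambda\in\Delta$, $\mathsf p_\lambda=\sum_k\lambda_k\mathsf p_k$ and $\hat{\mathsf p}_\lambda=\sum_k\lambda_k\hat{\mathsf p}_k$. The (vector-valued) Rademacher complexity of $\mathcal G_1$ for $\mathsf p_k$ and sample size $m$ is $\mathfrak R^k_m(\mathcal G_1)=\mathbb E_{(x_1,\dots,x_m)\sim\mathsf p_k^m}\,\frac1m\mathbb E_{\sigma}\big[\sup_{g\in\mathcal G_1}\sum_{i=1}^m\sum_{j=1}^p\sigma_{i,j}g(x_i,j)\big]$, where the $\sigma_{i,j}$ are independent uniform $\{-1,+1\}$-valued random variables. The expert coincidence norm is $C_\Pi=\sup_{x\in\mathcal X}\|(\hat\pi_1(x),\dots,\hat\pi_p(x))\|_2$. *)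

(* Defs.v *)
From HB Require Import structures.
From mathcomp Require Import all_boot all_order all_algebra.
From mathcomp Require Import all_classical all_reals all_analysis.
Set Implicit Arguments. Unset Strict Implicit. Unset Printing Implicit Defensive.
Import Order.TTheory GRing.Theory Num.Theory.
Local Open Scope ring_scope.
Local Open Scope classical_set_scope.

Section Defs.
Context {R : realType} {X : countType} {p : nat}.

Definition is_distr (P : X -> R) : Prop :=
  (forall x, 0 <= P x) /\ \esum_(x in [set: X]) (P x)%:E = 1%E.

(* expectation of f under the distribution P (all uses here have P*f >= 0) *)
Definition Ex (P : X -> R) (f : X -> R) : \bar R :=
  \esum_(x in [set: X]) (P x * f x)%:E.

Definition simplex (lam : 'I_p -> R) : Prop :=
  (forall k, 0 <= lam k) /\ \sum_(k < p) lam k = 1.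

Definition mixture (lam : 'I_p -> R) (P : 'I_p -> X -> R) (x : X) : R :=
  \sum_(k < p) lam k * P k x.

Definition is_gate (g : X -> 'I_p -> R) : Prop :=
  (forall x k, 0 <= g x k <= 1) /\ (forall x, \sum_(k < p) g x k = 1).

Definition pi_g (pihat : 'I_p -> X -> R) (g : X -> 'I_p -> R) (x : X) : R :=
  \sum_(k < p) g x k * pihat k x.

Definition G1 (pihat : 'I_p -> X -> R) : set (X -> 'I_p -> R) :=
  [set g | is_gate g /\ \esum_(x in [set: X]) (pi_g pihat g x)%:E = 1%E].

Definition empirical (s : seq X) (x : X) : R :=
  (count_mem x s)%:R / (size s)%:R.

Definition sample_weight (P : X -> R) (s : seq X) : R := \prod_(x <- s) P x.

Definition rademacher (pihat : 'I_p -> X -> R) (P : X -> R) (m : nat) : \bar R :=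
  \esum_(xs in [set: m.-tuple X])
    ((sample_weight P xs)%:E *
     ((m%:R)^-1 *
      ((2 ^+ (m * p))%:R^-1 *
       \sum_(sg : {ffun 'I_m * 'I_p -> bool})
         sup [set \sum_(i < m) \sum_(j < p)
                    ((-1) ^+ sg (i, j)) * g (tnth xs i) j
             | g in G1 pihat]))%:E)%E.

Definition coinc_norm (pihat : 'I_p -> X -> R) : R :=
  sup [set Num.sqrt (\sum_(k < p) pihat k x ^+ 2) | x in [set: X]].

End Defs.

(* Main.v *)
(** The bound on [ln (pihat k x)] gives [pihat k x >= expR (- M)], so [X] is finite and
    every expectation is a finite sum.  For one [k], the supremum over gates of the
    deviation between the true and the empirical loss changes by at most [M] when one
    sample point (of the unnormalised sum) is replaced, so McDiarmid's inequality
    concentrates it around its mean.  That mean is bounded one sample point at a time: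
    symmetrization by Jensen, then Maurer's vector contraction, which rests on the
    L1-L2 Khintchine inequality with the sharp constant [Num.sqrt 2] (proved here by the
    argument of Latala and Oleszkiewicz).  Independence of the samples turns the
    probability that all [p] deviations are small into a product, at least
    [(1 - delta / p) ^+ p >= 1 - delta]; the bound for a mixture follows by linearity. *)

Require Import Defs.
From HB Require Import structures.
From mathcomp Require Import all_boot all_order all_algebra.
From mathcomp Require Import all_classical all_reals all_analysis.
From mathcomp Require Import ring lra.
Import Order.TTheory GRing.Theory Num.Theory.
Local Open Scope ring_scope.
Local Open Scope classical_set_scope.

(** * Expectations over i.i.d. samples and the Khintchine inequality *)

Section IidMean.
Context {R : realType} {T : finType}.
Implicit Types (w : T -> R) (F G : seq T -> R).

(** The recursion peels off the first sample point, so bounds can go by induction on the sample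
    size; [iid_mean_tuple] identifies it with the weighted sum over tuples. *)
Fixpoint iid_mean w n F : R :=
  if n is k.+1 then \sum_x w x * iid_mean w k (fun s => F (x :: s))
  else F [::].

Lemma eq_iid_mean w n F G : (forall s, size s = n -> F s = G s) ->
  iid_mean w n F = iid_mean w n G.
Proof.
elim: n F G => [|n IH] F G eqFG /=; first exact: eqFG.
by apply: eq_bigr => x _; congr *%R; apply: IH => s sz; apply: eqFG; rewrite /= sz.
Qed.

Lemma iid_meanD w n F G :
  iid_mean w n (fun s => F s + G s) = iid_mean w n F + iid_mean w n G.
Proof.
elim: n F G => [//|n IH] F G /=; rewrite -big_split /=.
by apply: eq_bigr => x _; rewrite IH mulrDr.
Qed.

Lemma iid_meanZ w n c F : iid_mean w n (fun s => c * F s) = c * iid_mean w n F.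
Proof.
elim: n F => [//|n IH] F /=; rewrite mulr_sumr.
by apply: eq_bigr => x _; rewrite IH mulrCA.
Qed.

Lemma iid_meanB w n F G :
  iid_mean w n (fun s => F s - G s) = iid_mean w n F - iid_mean w n G.
Proof.
rewrite -[- iid_mean w n G]mulN1r -iid_meanZ -iid_meanD.
by apply: eq_iid_mean => s _; rewrite mulN1r.
Qed.

Lemma iid_mean_cst w n c : \sum_x w x = 1 -> iid_mean w n (fun=> c) = c.
Proof.
by move=> w1; elim: n => [//|n IH] /=; rewrite IH -mulr_suml w1 mul1r.
Qed.

Lemma iid_mean_sum w n (I : Type) (r : seq I) (F : I -> seq T -> R) :
  iid_mean w n (fun s => \sum_(i <- r) F i s) =
  \sum_(i <- r) iid_mean w n (F i).
Proof.
elim: r => [|i r IH].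
  rewrite big_nil -[RHS](mul0r (iid_mean w n (fun=> 0))) -iid_meanZ.
  by apply: eq_iid_mean => s _; rewrite big_nil mul0r.
rewrite big_cons -IH -iid_meanD.
by apply: eq_iid_mean => s _; rewrite big_cons.
Qed.

Lemma iid_mean_lin w n (J : finType) (c : J -> R) (F : J -> seq T -> R) :
  \sum_j c j * iid_mean w n (F j) = iid_mean w n (fun s => \sum_j c j * F j s).
Proof. by rewrite iid_mean_sum; apply: eq_bigr => j _; rewrite iid_meanZ. Qed.

Lemma le_iid_mean w n F G : (forall x, 0 <= w x) ->
  (forall s, size s = n -> F s <= G s) -> iid_mean w n F <= iid_mean w n G.
Proof.
move=> w0; elim: n F G => [|n IH] F G leFG /=; first exact: leFG.
apply: ler_sum => x _; apply: ler_wpM2l => //.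
by apply: IH => s sz; apply: leFG; rewrite /= sz.
Qed.

Lemma iid_mean_ge0 w n F : (forall x, 0 <= w x) ->
  (forall s, size s = n -> 0 <= F s) -> 0 <= iid_mean w n F.
Proof.
move=> w0 F0; have -> : 0 = iid_mean w n (fun s => 0 * F s).
  by rewrite iid_meanZ mul0r.
by apply: le_iid_mean => // s sz; rewrite mul0r F0.
Qed.

Lemma iid_mean_tuple w n F :
  \sum_(t : n.-tuple T) (\prod_(x <- t) w x) * F t = iid_mean w n F.
Proof.
elim: n F => [|n IH] F /=.
  rewrite (eq_bigr (fun=> F [::])) => [|t _]; last by rewrite tuple0 big_nil mul1r.
  by rewrite sumr_const card_tuple expn0.
rewrite [RHS](eq_bigr (fun x => \sum_(t : n.-tuple T) w x * (\prod_(y <- t) w y * F (x :: t)))).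
  2: by move=> x _; rewrite -IH mulr_sumr.
rewrite pair_bigA /=.
rewrite (reindex (fun xt : T * n.-tuple T => cons_tuple xt.1 xt.2)) /=.
  by apply: eq_bigr => -[x t] _ /=; rewrite big_cons mulrA.
exists (fun t => (thead t, behead_tuple t)) => [[x t]|t] _ /=.
  by congr pair; apply/val_inj.
by rewrite [RHS]tuple_eta; apply/val_inj.
Qed.

Lemma sqr_iid_mean_le w n F : (forall x, 0 <= w x) -> \sum_x w x = 1 ->
  iid_mean w n F ^+ 2 <= iid_mean w n (fun s => F s ^+ 2).
Proof.
move=> w0 w1; set m := iid_mean w n F.
have : 0 <= iid_mean w n (fun s => (F s ^+ 2 - (2 * m) * F s) + m ^+ 2).
  apply: iid_mean_ge0 => // s _; have := sqr_ge0 (F s - m); nra.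
rewrite iid_meanD iid_meanB iid_meanZ iid_mean_cst// -/m; lra.
Qed.

End IidMean.

(** * Poincare inequalities on the Boolean cube and the squared Khintchine inequality *)

Section Khintchine.
Context {R : realType}.
Implicit Types (F G : seq bool -> R).

Let coin_mean p F := iid_mean (fun _ : bool => 2^-1 : R) p F.

Let coin_ge0 (b : bool) : 0 <= 2^-1 :> R. Proof. by []. Qed.

Let coin_sum1 : \sum_(b : bool) (2^-1 : R) = 1.
Proof. by rewrite big_bool /=; lra. Qed.

Let coin_meanS p F : coin_mean p.+1 F =
  (coin_mean p (fun s => F (true :: s)) + coin_mean p (fun s => F (false :: s))) / 2.
Proof. by rewrite /coin_mean /= big_bool /=; lra. Qed.

(** The Dirichlet form of the cube: a quarter of the sum, over the coordinates, of the mean squared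
    jump. In Fourier terms it weights the squared coefficient of a set by the size of that set. *)
Fixpoint dirichlet p F : R :=
  if p is q.+1 then
    (dirichlet q (fun s => F (true :: s)) + dirichlet q (fun s => F (false :: s))) / 2
    + coin_mean q (fun s => (F (true :: s) - F (false :: s)) ^+ 2) / 4
  else 0.

Lemma dirichletZ p c F : dirichlet p (fun s => c * F s) = c ^+ 2 * dirichlet p F.
Proof.
elim: p F => [|p IH] F /=; first by rewrite mulr0.
rewrite !IH; set A := coin_mean p _; set B := coin_mean p _.
have -> : A = c ^+ 2 * B.
  by rewrite /A /coin_mean -iid_meanZ; apply: eq_iid_mean => s _; ring.
by field.
Qed.

(** The form is quadratic; this lets [even_poincare] pass from the two halves of a function to their
    half sum and half difference. *)
Lemma dirichlet_parallelogram p F G :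
  dirichlet p (fun s => F s + G s) + dirichlet p (fun s => F s - G s) =
  2 * dirichlet p F + 2 * dirichlet p G.
Proof.
elim: p F G => [|p IH] F G /=; first by ring.
have E1 := IH (fun s => F (true :: s)) (fun s => G (true :: s)).
have E0 := IH (fun s => F (false :: s)) (fun s => G (false :: s)).
have EE : coin_mean p (fun s => (F (true :: s) + G (true :: s)
      - (F (false :: s) + G (false :: s))) ^+ 2)
    + coin_mean p (fun s => (F (true :: s) - G (true :: s)
      - (F (false :: s) - G (false :: s))) ^+ 2)
   = 2 * coin_mean p (fun s => (F (true :: s) - F (false :: s)) ^+ 2)
   + 2 * coin_mean p (fun s => (G (true :: s) - G (false :: s)) ^+ 2).
  by rewrite /coin_mean -!iid_meanZ -!iid_meanD; apply: eq_iid_mean => s _; ring.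
lra.
Qed.

(** Along the first bit the variance is the average variance of the two halves plus a quarter of the
    squared gap between their means. By Jensen ([J]) that squared gap is at most the mean squared
    jump. *)
Lemma poincare p F :
  coin_mean p (fun s => F s ^+ 2) - coin_mean p F ^+ 2 <= dirichlet p F.
Proof.
elim: p F => [|p IH] F /=; first by rewrite /coin_mean /= subrr.
have J := sqr_iid_mean_le _ p (fun s => F (true :: s) - F (false :: s)) coin_ge0 coin_sum1.
rewrite iid_meanB -/coin_mean in J.
have I1 := IH (fun s => F (true :: s)); have I0 := IH (fun s => F (false :: s)).
rewrite !coin_meanS; rewrite /coin_mean in I1 I0 J *; nra.
Qed.

Let coin_mean_negb p F : coin_mean p (fun s => F (map negb s)) = coin_mean p F.
Proof.
elim: p F => [//|p IH] F; rewrite !coin_meanS /=.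
rewrite (IH (fun s => F (false :: s))) (IH (fun s => F (true :: s))).
by rewrite addrC.
Qed.

(* An even function has no Fourier weight on level one, so the Poincare constant halves. *)
Lemma even_poincare p F :
  (forall s, size s = p -> F (map negb s) = F s) ->
  2 * (coin_mean p (fun s => F s ^+ 2) - coin_mean p F ^+ 2) <= dirichlet p F.
Proof.
elim: p F => [|p IH] F evF; first by rewrite /coin_mean /= subrr mulr0.
pose F1 s := F (true :: s); pose F0 s := F (false :: s).
have F10 s : size s = p -> F0 (map negb s) = F1 s.
  by move=> sz; rewrite /F0 /F1 -(evF (true :: s)) //= sz.
have F01 s : size s = p -> F1 (map negb s) = F0 s.
  by move=> sz; rewrite /F0 /F1 -(evF (false :: s)) //= sz.
(* [u] is even under negation and inherits the induction hypothesis. [v] is odd, hence of mean zero,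
   and its second moment counts twice: through [poincare] and through the jump in the first bit. *)
pose u s := 2^-1 * (F1 s + F0 s); pose v s := 2^-1 * (F1 s - F0 s).
have Iu : 2 * (coin_mean p (fun s => u s ^+ 2) - coin_mean p u ^+ 2) <= dirichlet p u.
  by apply: IH => s sz; rewrite /u F10 // F01 // addrC.
have Iv := poincare p v.
have E10 : coin_mean p F1 = coin_mean p F0.
  by rewrite -[RHS]coin_mean_negb; apply: eq_iid_mean => s sz; rewrite F10.
have Eu : coin_mean p u = coin_mean p F0.
  by rewrite /u /coin_mean iid_meanZ iid_meanD -/(coin_mean p F1) E10 /coin_mean; field.
have Ev : coin_mean p v = 0.
  by rewrite /v /coin_mean iid_meanZ iid_meanB -/(coin_mean p F1) E10 subrr mulr0.
have Euv : coin_mean p (fun s => F1 s ^+ 2) + coin_mean p (fun s => F0 s ^+ 2) =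
    2 * coin_mean p (fun s => u s ^+ 2) + 2 * coin_mean p (fun s => v s ^+ 2).
  rewrite /coin_mean -!iid_meanZ -!iid_meanD; apply: eq_iid_mean => s _.
  by rewrite /u /v; field.
have Ed : coin_mean p (fun s => (F1 s - F0 s) ^+ 2) = 4 * coin_mean p (fun s => v s ^+ 2).
  by rewrite /coin_mean -iid_meanZ; apply: eq_iid_mean => s _; rewrite /v; field.
have Dp := dirichlet_parallelogram p F1 F0.
have Du : dirichlet p u = 4^-1 * dirichlet p (fun s => F1 s + F0 s).
  by rewrite /u (dirichletZ p 2^-1 (fun s => F1 s + F0 s)); field.
have Dv : dirichlet p v = 4^-1 * dirichlet p (fun s => F1 s - F0 s).
  by rewrite /v (dirichletZ p 2^-1 (fun s => F1 s - F0 s)); field.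
rewrite Ev in Iv; rewrite Eu in Iu.
have -> : dirichlet p.+1 F = (dirichlet p F1 + dirichlet p F0) / 2
    + coin_mean p (fun s => (F1 s - F0 s) ^+ 2) / 4 by [].
have -> : coin_mean p.+1 F = (coin_mean p F1 + coin_mean p F0) / 2 by exact: coin_meanS.
have -> : coin_mean p.+1 (fun s => F s ^+ 2) = (coin_mean p (fun s => F1 s ^+ 2)
    + coin_mean p (fun s => F0 s ^+ 2)) / 2 by exact: coin_meanS.
rewrite E10 Ed; nra.
Qed.

(** The adjacency operator of the cube, summing over the neighbours of [s]. *)
Fixpoint flip_sum p F (s : seq bool) : R :=
  if (p, s) is (q.+1, b :: t) then
    F (~~ b :: t) + flip_sum q (fun t => F (b :: t)) t
  else 0.

(** Expanding the squared jumps gives the quadratic form of the graph Laplacian, half of degree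
    minus adjacency. *)
Lemma dirichlet_flip p F : dirichlet p F =
  (p%:R * coin_mean p (fun s => F s ^+ 2)
   - coin_mean p (fun s => F s * flip_sum p F s)) / 2.
Proof.
elim: p F => [|p IH] F /=; first by rewrite /coin_mean /= mulr0 mul0r subrr mul0r.
rewrite !IH !coin_meanS /= -natr1.
have E b : coin_mean p (fun s => F (b :: s) *
      (F (~~ b :: s) + flip_sum p (fun t => F (b :: t)) s)) =
    coin_mean p (fun s => F (true :: s) * F (false :: s)) +
    coin_mean p (fun s => F (b :: s) * flip_sum p (fun t => F (b :: t)) s).
  by rewrite /coin_mean -iid_meanD; apply: eq_iid_mean => s _; case: b => /=; ring.
rewrite (E true) (E false).
have -> : coin_mean p (fun s => (F (true :: s) - F (false :: s)) ^+ 2) =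
    coin_mean p (fun s => F (true :: s) ^+ 2) + coin_mean p (fun s => F (false :: s) ^+ 2)
    - 2 * coin_mean p (fun s => F (true :: s) * F (false :: s)).
  by rewrite /coin_mean -iid_meanZ -iid_meanD -iid_meanB; apply: eq_iid_mean => s _; ring.
by field.
Qed.

Lemma normr_flip_sum_le p F s :
  `|flip_sum p F s| <= flip_sum p (fun t => `|F t|) s.
Proof.
elim: p F s => [|p IH] F [|b s] /=; rewrite ?normr0 //.
by apply: le_trans (ler_normD _ _) _; rewrite lerD2l.
Qed.

Fixpoint signed_sum (a : seq R) (s : seq bool) : R :=
  if (a, s) is (x :: a', b :: s') then (-1) ^+ b * x + signed_sum a' s' else 0.

(** Flipping one sign subtracts twice that term, so over all flips the signed sum is lost exactly
    twice. The constant [c] collects the signs already passed in the induction. *)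
Lemma flip_sum_signed c a s : size s = size a ->
  flip_sum (size a) (fun t => c + signed_sum a t) s =
  (size a)%:R * c + ((size a)%:R - 2) * signed_sum a s.
Proof.
elim: a s c => [|x a IH] [|b s] c //=; first by move=> _; rewrite mul0r mulr0 addr0.
case=> sz.
rewrite (_ : (fun t => c + ((-1) ^+ b * x + signed_sum a t)) =
  (fun t => (c + (-1) ^+ b * x) + signed_sum a t)); last first.
  by apply/funext => t; rewrite addrA.
by rewrite IH // -natr1; case: b => /=; rewrite ?expr1 ?expr0; ring.
Qed.

Lemma signed_sum_negb a s : signed_sum a (map negb s) = - signed_sum a s.
Proof.
elim: a s => [|x a IH] [|b s] /=; rewrite ?oppr0 // IH.
by case: b => /=; rewrite ?expr1 ?expr0; ring.
Qed.

Lemma signed_sum_sqr_mean a c :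
  coin_mean (size a) (fun s => (c + signed_sum a s) ^+ 2) =
  c ^+ 2 + \sum_(x <- a) x ^+ 2.
Proof.
elim: a c => [|x a IH] c; first by rewrite big_nil /coin_mean /= !addr0.
rewrite coin_meanS big_cons /=.
have E b : coin_mean (size a) (fun s => (c + ((-1) ^+ b * x + signed_sum a s)) ^+ 2) =
   (c + (-1) ^+ b * x) ^+ 2 + \sum_(x <- a) x ^+ 2.
  by rewrite -IH; apply: eq_iid_mean => s _; rewrite addrA.
by rewrite (E true) (E false) /= expr1 expr0; field.
Qed.

(* The graph Laplacian of [fun s => `|signed_sum a s|] is pointwise at most the function
   itself, which bounds its Dirichlet form by its second moment. *)
Lemma khintchine_sqr a :
  \sum_(x <- a) x ^+ 2 <=
  2 * coin_mean (size a) (fun s => `|signed_sum a s|) ^+ 2.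
Proof.
set F := fun s => `|signed_sum a s|; set p := size a.
have EF : coin_mean p (fun s => F s ^+ 2) = \sum_(x <- a) x ^+ 2.
  have := signed_sum_sqr_mean a 0; rewrite expr0n add0r => <-.
  by apply: eq_iid_mean => s _; rewrite /F real_normK ?num_real// add0r.
have evF : 2 * (coin_mean p (fun s => F s ^+ 2) - coin_mean p F ^+ 2) <= dirichlet p F.
  by apply: even_poincare => s _; rewrite /F signed_sum_negb normrN.
have DF : dirichlet p F <= coin_mean p (fun s => F s ^+ 2).
  rewrite dirichlet_flip.
  have : coin_mean p (fun s => (p%:R - 2) * F s ^+ 2) <=
         coin_mean p (fun s => F s * flip_sum p F s).
    apply: le_iid_mean => // s sz.
    rewrite expr2 mulrCA; apply: ler_wpM2l; first exact: normr_ge0.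
    apply: le_trans (normr_flip_sum_le _ _ _).
    have := flip_sum_signed 0 a s sz; rewrite mulr0 add0r.
    rewrite (_ : (fun t => 0 + signed_sum a t) = signed_sum a); last first.
      by apply/funext => t; rewrite add0r.
    by move=> ->; rewrite normrM; apply: ler_wpM2r; [exact: normr_ge0|exact: ler_norm].
  rewrite /coin_mean iid_meanZ; lra.
lra.
Qed.

End Khintchine.

(** * Concentration *)

Section Hoeffding.
Import numFieldNormedType.Exports.
Context {R : realType}.

Lemma is_derive_ge0_le (f df : R -> R) (h : R) :
  (forall x : R, is_derive x (1 : R) f (df x)) ->
  (forall x, 0 <= x -> 0 <= df x) -> 0 <= h -> f 0 <= f h.
Proof.
move=> fd df0 h0.
have cf : continuous f.
  move=> x; apply: differentiable_continuous; apply/derivable1_diffP.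
  by have [] := fd x.
have [c /andP[c0 _] E] := MVT_segment h0 (fun x _ => fd x) (continuous_subspaceT cf).
by rewrite -subr_ge0 E subr0 mulr_ge0 // df0.
Qed.

(** The left side is a logistic curve through [q] at 0; its derivative has the form [t * (1 - t)]
    and is at most 1/4. *)
Lemma logistic_le (q h : R) : 0 <= q <= 1 -> 0 <= h ->
  q * expR h / (1 - q + q * expR h) <= q + h / 4.
Proof.
move=> /andP[q0 q1] h0.
have D0 x : 0 < 1 - q + q * expR x by have := expR_gt0 x; nra.
pose f x : R := q + x / 4 - q * expR x * (1 - q + q * expR x)^-1.
pose df x : R := 4^-1 - (q * expR x / (1 - q + q * expR x)) * (1 - q * expR x / (1 - q + q * expR x)).
have fd x : is_derive x (1 : R) f (df x).
  have Dn : 1 - q + q * expR x != 0 by rewrite gt_eqF.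
  apply: is_derive_eq; rewrite /df /GRing.scale /=; field.
  by [].
have : f 0 <= f h.
  apply: (is_derive_ge0_le _ _ _ fd) => // x _; rewrite /df.
  set t := _ / _; have := sqr_ge0 (t - 2^-1); nra.
rewrite /f expR0 mulr1 subrK invr1; lra.
Qed.

(** The logarithm of the left side vanishes at 0 and has the logistic curve as derivative, so
    [logistic_le] is integrated once more. *)
Lemma bernoulli_mgf_le (q h : R) : 0 <= q <= 1 -> 0 <= h ->
  1 - q + q * expR h <= expR (q * h + h ^+ 2 / 8).
Proof.
move=> q01 h0; have /andP[q0 q1] := q01.
have D0 x : 0 < 1 - q + q * expR x by have := expR_gt0 x; nra.
pose f x : R := x ^+ 2 / 8 + q * x - ln (1 - q + q * expR x).
pose df x : R := x / 4 + q - q * expR x / (1 - q + q * expR x).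
have fd x : is_derive x (1 : R) f (df x).
  have L : is_derive x (1 : R) (fun x => ln (1 - q + q * expR x)) (q * expR x / (1 - q + q * expR x)).
    have Dd : is_derive x (1 : R) (fun x => 1 - q + q * expR x) (q * expR x).
      by apply: is_derive_eq; rewrite /GRing.scale /=; ring.
    rewrite mulrC; exact: (@is_derive1_comp _ (@ln R) (fun y => 1 - q + q * expR y)
      x _ _ (is_derive1_ln (D0 x)) Dd).
  by apply: is_derive_eq; rewrite /df /GRing.scale /=; field; rewrite gt_eqF.
have : f 0 <= f h.
  apply: (is_derive_ge0_le _ _ _ fd) => // x x0; rewrite /df.
  by have := logistic_le _ _ q01 x0; lra.
rewrite /f expR0 mulr1 subrK ln1 => F0.
by rewrite -[leLHS]lnK ?posrE// ler_expR; lra.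
Qed.

Lemma expR_chord_le (h t : R) : 0 <= t <= 1 -> expR (h * t) <= 1 - t + t * expR h.
Proof.
move=> /andP[t0 t1].
(* The tangent at [h * t] lies below the exponential; averaging it at [0] and [h] with weights
   [1 - t] and [t] gives the chord. *)
have T (a : R) : expR (h * t) * (1 + (a - h * t)) <= expR a.
  rewrite -[in leRHS](subrK (h * t) a) expRD mulrC.
  by rewrite ler_pM2r ?expR_gt0//; exact: expR_ge1Dx.
have := T 0; have := T h; rewrite expR0 => Th T0.
have -> : expR (h * t) = (1 - t) * (expR (h * t) * (1 + (0 - h * t)))
    + t * (expR (h * t) * (1 + (h - h * t))) by ring.
rewrite -[X in _ <= X + _]mulr1; apply: lerD; apply: ler_wpM2l => //; lra.
Qed.

(** Rescaling [V] from its minimum puts it in [0,1]; replacing the exponential by its chord then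
    leaves only a Bernoulli variable of mean [q]. *)
Lemma hoeffding_lemma (T : finType) (w V : T -> R) (c t : R) :
  (forall x, 0 <= w x) -> \sum_x w x = 1 -> 0 < c -> 0 <= t ->
  (forall x y, V x - V y <= c) ->
  \sum_x w x * expR (t * (V x - \sum_y w y * V y)) <= expR (t ^+ 2 * c ^+ 2 / 8).
Proof.
move=> w0 w1 c0 t0 Vc.
have [x0 _|T0] := pickP T; last first.
  by rewrite big_pred0 ?expR_ge0.
pose a := V [arg min_(x < x0) V x]%O.
have aV x : a <= V x by rewrite /a; case: Order.TotalTheory.arg_minP => // i _; exact.
pose th x := (V x - a) / c.
have th01 x : 0 <= th x <= 1.
  by rewrite /th divr_ge0 ?subr_ge0 ?(ltW c0)//= ler_pdivrMr// mul1r Vc.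
have Vth x : V x = a + c * th x by rewrite /th; field; rewrite gt_eqF.
pose q := \sum_x w x * th x.
have q01 : 0 <= q <= 1.
  rewrite sumr_ge0 => [|x _]; last by rewrite mulr_ge0//; case/andP: (th01 x).
  rewrite -w1; apply: ler_sum => x _; rewrite -[leRHS]mulr1.
  by apply: ler_wpM2l => //; case/andP: (th01 x).
have EV : \sum_y w y * V y = a + c * q.
  rewrite (eq_bigr (fun y => w y * a + c * (w y * th y))) => [|y _]; last first.
    by rewrite Vth; ring.
  by rewrite big_split /= -mulr_suml w1 mul1r -mulr_sumr.
rewrite EV.
have -> : \sum_x w x * expR (t * (V x - (a + c * q))) =
   expR (- (t * c * q)) * \sum_x w x * expR ((t * c) * th x).
  rewrite mulr_sumr; apply: eq_bigr => x _; rewrite mulrCA -expRD Vth.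
  by congr (_ * expR _); ring.
have le1 : \sum_x w x * expR ((t * c) * th x) <= 1 - q + q * expR (t * c).
  have -> : 1 - q + q * expR (t * c) = \sum_x w x * (1 - th x + th x * expR (t * c)).
    rewrite [RHS](eq_bigr (fun x => w x - w x * th x + (w x * th x) * expR (t * c))).
      by rewrite big_split /= sumrB w1 -mulr_suml.
    by move=> x _; ring.
  by apply: ler_sum => x _; apply: ler_wpM2l => //; exact: expR_chord_le.
have := bernoulli_mgf_le q (t * c) q01 (mulr_ge0 t0 (ltW c0)).
move=> /(le_trans le1); rewrite -(ler_pM2l (expR_gt0 (- (t * c * q)))) => /le_trans -> //.
rewrite -expRD ler_expR; lra.
Qed.

(* All lengths are quantified over, so that the property passes to [fun s => F (x :: s)]. *)
Definition bounded_difference (T : Type) (c : R) (F : seq T -> R) :=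
  forall (s1 s2 : seq T) x y, F (s1 ++ x :: s2) - F (s1 ++ y :: s2) <= c.

(** Martingale argument: given the first point, the induction hypothesis controls the fluctuation
    around the conditional mean [V x], and Hoeffding's lemma controls that of [V] itself. *)
Lemma mcdiarmid_mgf (T : finType) (w : T -> R) (c t : R) n (F : seq T -> R) :
  (forall x, 0 <= w x) -> \sum_x w x = 1 -> 0 < c -> 0 <= t ->
  bounded_difference T c F ->
  iid_mean w n (fun s => expR (t * (F s - iid_mean w n F))) <=
  expR (n%:R * (t ^+ 2 * c ^+ 2 / 8)).
Proof.
move=> w0 w1 c0 t0; elim: n F => [|n IH] F bF.
  by rewrite /= subrr mulr0 mul0r.
pose V x := iid_mean w n (fun s => F (x :: s)).
have Vc x y : V x - V y <= c.
  rewrite /V -iid_meanB -(iid_mean_cst w n c w1).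
  by apply: le_iid_mean => // s _; exact: (bF [::]).
have EF : iid_mean w n.+1 F = \sum_x w x * V x by [].
rewrite EF /=.
have step x : iid_mean w n (fun s => expR (t * (F (x :: s) - \sum_y w y * V y))) <=
    expR (t * (V x - \sum_y w y * V y)) * expR (n%:R * (t ^+ 2 * c ^+ 2 / 8)).
  rewrite (eq_iid_mean _ _ _ (fun s => expR (t * (V x - \sum_y w y * V y)) *
     expR (t * (F (x :: s) - V x)))); last first.
    by move=> s _; rewrite -expRD; congr expR; ring.
  rewrite iid_meanZ ler_pM2l ?expR_gt0//; apply: IH => s1 s2 y z.
  exact: (bF (x :: s1)).
rewrite -natr1 mulrDl mul1r expRD mulrC.
apply: (@le_trans _ _ (\sum_x w x * (expR (t * (V x - \sum_y w y * V y)) *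
    expR (n%:R * (t ^+ 2 * c ^+ 2 / 8))))).
  by apply: ler_sum => x _; apply: ler_wpM2l.
under eq_bigr do rewrite mulrA.
rewrite -mulr_suml ler_pM2r ?expR_gt0//.
exact: hoeffding_lemma.
Qed.

Lemma mcdiarmid (T : finType) (w : T -> R) (c eps : R) n (F : seq T -> R) :
  (forall x, 0 <= w x) -> \sum_x w x = 1 -> 0 < c -> 0 <= eps -> (0 < n)%N ->
  bounded_difference T c F ->
  iid_mean w n (fun s => (iid_mean w n F + eps < F s)%R%:R) <=
  expR (- (2 * eps ^+ 2 / (n%:R * c ^+ 2))).
Proof.
move=> w0 w1 c0 eps0 n0 bF.
have n0R : (0 : R) < n%:R by rewrite ltr0n.
(* The Chernoff parameter, minimising [- t * eps + n%:R * (t ^+ 2 * c ^+ 2 / 8)]. *)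
pose t := 4 * eps / (n%:R * c ^+ 2).
have t0 : 0 <= t by rewrite /t divr_ge0// mulr_ge0// exprn_ge0// ltW.
apply: (@le_trans _ _ (iid_mean w n (fun s => expR (- (t * eps)) *
    expR (t * (F s - iid_mean w n F))))).
  apply: le_iid_mean => // s _; rewrite -expRD; case: ltP => /= [ltF|_].
    by rewrite -[leLHS]expR0 ler_expR; nra.
  exact: expR_ge0.
rewrite iid_meanZ.
have := mcdiarmid_mgf _ _ _ _ n _ w0 w1 c0 t0 bF.
rewrite -(ler_pM2l (expR_gt0 (- (t * eps)))) => /le_trans -> //.
rewrite -expRD ler_expR /t le_eqVlt; apply/orP; left; apply/eqP; field.
by rewrite !gt_eqF.
Qed.

End Hoeffding.

(** * Symmetrization and vector contraction *)

Section SignMean.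
Context {R : realType}.

Definition sign_mean p (F : {ffun 'I_p -> bool} -> R) : R :=
  (2 ^+ p)^-1 * \sum_s F s.

Lemma le_sign_mean p (F H : {ffun 'I_p -> bool} -> R) :
  (forall s, F s <= H s) -> sign_mean p F <= sign_mean p H.
Proof.
by move=> FH; rewrite /sign_mean ler_pM2l ?invr_gt0 ?exprn_gt0//; exact: ler_sum.
Qed.

Lemma sign_meanD p (F H : {ffun 'I_p -> bool} -> R) :
  sign_mean p (fun s => F s + H s) = sign_mean p F + sign_mean p H.
Proof. by rewrite /sign_mean big_split /= mulrDr. Qed.

Lemma sign_meanZ p c (F : {ffun 'I_p -> bool} -> R) :
  sign_mean p (fun s => c * F s) = c * sign_mean p F.
Proof. by rewrite /sign_mean -mulr_sumr mulrCA. Qed.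

Lemma sign_mean_cst p c : sign_mean p (fun=> c) = c.
Proof.
rewrite /sign_mean sumr_const card_ffun card_bool card_ord -[c *+ _]mulr_natl natrX mulrA.
by rewrite mulVf ?mul1r// expf_neq0.
Qed.

Lemma sign_meanN p (F : {ffun 'I_p -> bool} -> R) :
  sign_mean p (fun s => F [ffun j => ~~ s j]) = sign_mean p F.
Proof.
rewrite /sign_mean; congr *%R.
have inv : involutive (fun s : {ffun 'I_p -> bool} => [ffun j => ~~ s j]).
  by move=> s; apply/ffunP => j; rewrite !ffunE negbK.
by rewrite [RHS](reindex_inj (can_inj inv)).
Qed.

Lemma signed_sumE n (a : seq R) s : size a = n -> size s = n ->
  signed_sum a s = \sum_(i < n) (-1) ^+ nth false s i * nth 0 a i.
Proof.
elim: n a s => [|n IH] [|x a] [|b s] //=; first by rewrite big_ord0.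
by move=> [sa] [ss]; rewrite big_ord_recl /=; congr +%R; exact: IH.
Qed.

(** The square root of [khintchine_sqr], carried from bit sequences to sign vectors indexed by
    ['I_p]. *)
Lemma khintchine p (a : 'I_p -> R) :
  Num.sqrt (\sum_j a j ^+ 2) <=
  Num.sqrt 2 * sign_mean p (fun s => `|\sum_j (-1) ^+ s j * a j|).
Proof.
set m := sign_mean _ _.
have m0 : 0 <= m.
  rewrite -[leLHS](sign_mean_cst p 0); apply: le_sign_mean => s; exact: normr_ge0.
pose b := [seq a j | j <- enum 'I_p].
have sb : size b = p by rewrite size_map size_enum_ord.
have := khintchine_sqr b; rewrite sb big_map big_enum /= => K.
have Em : iid_mean (fun _ : bool => 2^-1 : R) p (fun s => `|signed_sum b s|) = m.
  rewrite -iid_mean_tuple /m /sign_mean mulr_sumr.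
  rewrite (reindex (fun s : {ffun 'I_p -> bool} => [tuple s i | i < p])) /=.
    apply: eq_bigr => s _; rewrite big_tuple big_const_ord iter_mulr_1 exprVn.
    suff -> : signed_sum b [seq s j | j <- enum 'I_p] = \sum_j (-1) ^+ s j * a j.
      by rewrite card_ord.
    rewrite (signed_sumE p) ?size_map -?enumT ?size_enum_ord//.
    apply: eq_bigr => i _.
    have szi : (i < size (enum 'I_p))%N by rewrite size_enum_ord.
    rewrite /b (nth_map i) // [X in _ * X](nth_map i) //.
    by have -> : nth i (enum 'I_p) i = i by exact: nth_ord_enum.
  exists (fun t : p.-tuple bool => [ffun i => tnth t i]) => [s|t] _.
    by apply/ffunP => i; rewrite ffunE tnth_mktuple.
  by apply: eq_from_tnth => i; rewrite tnth_mktuple ffunE.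
rewrite Em in K.
rewrite -[m]ger0_norm// -sqrtr_sqr -sqrtrM//; exact: ler_wsqrtr.
Qed.

End SignMean.

(** * Suprema of bounded families, contraction and symmetrization *)

Section SupOn.
Context {R : realType} {I : Type}.
Variable A : set I.
Hypothesis A0 : A !=set0.
Implicit Types h : I -> R.

Let eq_ler (x y : R) : x = y -> x <= y.
Proof. by move=> ->. Qed.

(** [sup] takes a default value on sets without an upper bound, so boundedness is carried along; the
    two-sided form survives negation. *)
Definition bounded_on h := exists K, forall i, A i -> `|h i| <= K.

Definition sup_on h : R := sup [set h i | i in A].

Lemma bounded_on_cst c : bounded_on (fun=> c).
Proof. by exists `|c|. Qed.

Lemma bounded_onD h1 h2 :
  bounded_on h1 -> bounded_on h2 -> bounded_on (fun i => h1 i + h2 i).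
Proof.
move=> [K1 b1] [K2 b2]; exists (K1 + K2) => i Ai.
by apply: le_trans (ler_normD _ _) _; rewrite lerD ?b1 ?b2.
Qed.

Lemma bounded_onZ c h : bounded_on h -> bounded_on (fun i => c * h i).
Proof.
move=> [K b]; exists (`|c| * K) => i Ai.
by rewrite normrM ler_wpM2l// b.
Qed.

Lemma bounded_onN h : bounded_on h -> bounded_on (fun i => - h i).
Proof. by move=> [K b]; exists K => i Ai; rewrite normrN b. Qed.

Lemma bounded_on_sum (J : Type) (r : seq J) (h : J -> I -> R) :
  (forall j, bounded_on (h j)) -> bounded_on (fun i => \sum_(j <- r) h j i).
Proof.
move=> b; elim: r => [|j r [K IH]].
  by exists 0 => i _; rewrite big_nil normr0.
have [Kj bj] := b j; exists (Kj + K) => i Ai; rewrite big_cons.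
by apply: le_trans (ler_normD _ _) _; rewrite lerD ?bj ?IH.
Qed.

Lemma sup_on_ge h i : bounded_on h -> A i -> h i <= sup_on h.
Proof.
move=> [K b] Ai; apply: ub_le_sup; last by exists i.
by exists K => _ [j Aj <-]; exact: le_trans (ler_norm _) (b j Aj).
Qed.

Lemma sup_on_le h K : (forall i, A i -> h i <= K) -> sup_on h <= K.
Proof.
move=> hK; apply: ge_sup; first by have [i Ai] := A0; exists (h i), i.
by move=> _ [i Ai <-]; exact: hK.
Qed.

Lemma eq_sup_on h1 h2 : (forall i, A i -> h1 i = h2 i) -> sup_on h1 = sup_on h2.
Proof.
move=> E; congr sup; apply/seteqP; split => _ [i Ai <-]; exists i => //;
  by rewrite E.
Qed.

Lemma sup_onZ_le c h : 0 <= c -> bounded_on h ->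
  sup_on (fun i => c * h i) <= c * sup_on h.
Proof.
by move=> c0 bh; apply: sup_on_le => i Ai; apply: ler_wpM2l => //; exact: sup_on_ge.
Qed.

(** Makes two suprema one problem about pairs of competitors, the setting in which
    [sign_contraction] exchanges them. *)
Lemma sup_onD_le h1 h2 K :
  (forall i j, A i -> A j -> h1 i + h2 j <= K) -> sup_on h1 + sup_on h2 <= K.
Proof.
move=> H; rewrite -lerBrDr; apply: sup_on_le => i Ai.
rewrite lerBrDr addrC -lerBrDr; apply: sup_on_le => j Aj.
by rewrite lerBrDr addrC; exact: H.
Qed.

(* Maurer's contraction: Khintchine linearises the Euclidean norm, and the absolute value
   it produces is removed because the competitors [i] and [i'] may be exchanged. *)
Lemma sign_contraction p (psi xi : I -> R) (phi : 'I_p -> I -> R) :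
  bounded_on xi -> (forall j, bounded_on (phi j)) ->
  (forall i i', A i -> A i' ->
     `|psi i - psi i'| <= Num.sqrt (\sum_j (phi j i - phi j i') ^+ 2)) ->
  (sup_on (fun i => psi i + xi i) + sup_on (fun i => - psi i + xi i)) / 2 <=
  sign_mean p (fun s =>
    sup_on (fun i => Num.sqrt 2 * (\sum_j (-1) ^+ s j * phi j i) + xi i)).
Proof.
move=> bxi bphi lip.
pose L (s : {ffun 'I_p -> bool}) i : R := Num.sqrt 2 * (\sum_j (-1) ^+ s j * phi j i).
have bL s : bounded_on (L s).
  by apply/bounded_onZ/bounded_on_sum => j; exact: bounded_onZ.
have NL (s : {ffun 'I_p -> bool}) i : L [ffun j => ~~ s j] i = - L s i.
  rewrite /L -mulrN -sumrN; congr *%R; apply: eq_bigr => j _.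
  by rewrite ffunE; case: (s j); rewrite /= ?expr0 ?expr1; ring.
rewrite ler_pdivrMr//.
(* Negating every sign preserves the mean, so the doubled right side has one supremum for [L] and
   one for [- L], matching the left side. *)
have -> : sign_mean p (fun s : {ffun 'I_p -> bool} => sup_on (fun i => L s i + xi i)) * 2 =
  sign_mean p (fun s : {ffun 'I_p -> bool} => sup_on (fun i => L s i + xi i) + sup_on (fun i => - L s i + xi i)).
  rewrite sign_meanD -[X in _ = _ + X]sign_meanN.
  rewrite (_ : (fun s : {ffun 'I_p -> bool} => sup_on (fun i => - L [ffun j => ~~ s j] i + xi i)) =
     (fun s : {ffun 'I_p -> bool} => sup_on (fun i => L s i + xi i))); first by ring.
  by apply/funext => s; apply: eq_sup_on => i _; rewrite NL opprK.
apply: sup_onD_le => i i' Ai Ai'.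
have pd : psi i - psi i' <= sign_mean p (fun s => `|L s i - L s i'|).
  apply: le_trans (ler_norm _) _; apply: le_trans (lip _ _ Ai Ai') _.
  apply: le_trans (khintchine _ _) _; rewrite -sign_meanZ; apply: le_sign_mean => s.
  rewrite /L -mulrBr -sumrB normrM ger0_norm ?sqrtr_ge0//.
  by under [X in _ <= _ * `|X|]eq_bigr do rewrite -mulrBr.
have -> : psi i + xi i + (- psi i' + xi i') = (psi i - psi i') + (xi i + xi i') by ring.
apply: (le_trans (y := sign_mean p (fun s => `|L s i - L s i'| + (xi i + xi i')))).
  by rewrite sign_meanD sign_mean_cst lerD2r.
apply: le_sign_mean => s.
have bP : bounded_on (fun i => L s i + xi i) by exact: bounded_onD.
have bM : bounded_on (fun i => - L s i + xi i).
  by apply: bounded_onD => //; exact: bounded_onN.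
have P1 := sup_on_ge _ _ bP Ai; have P2 := sup_on_ge _ _ bP Ai'.
have M1 := sup_on_ge _ _ bM Ai; have M2 := sup_on_ge _ _ bM Ai'.
rewrite /= in P1 P2 M1 M2.
by case: (leP 0 (L s i - L s i')) => ?; [rewrite ger0_norm//|rewrite ltr0_norm//]; lra.
Qed.

Section Symmetrization.
Context {T : finType} {p : nat}.
Variables (w : T -> R) (f : I -> T -> R) (phi : I -> T -> 'I_p -> R).
Hypotheses (w0 : forall x, 0 <= w x) (w1 : \sum_x w x = 1).
Hypothesis bf : forall x, bounded_on (fun i => f i x).
Hypothesis bphi : forall x j, bounded_on (fun i => phi i x j).
Hypothesis lip : forall x i i', A i -> A i' ->
  `|f i x - f i' x| <= Num.sqrt (\sum_j (phi i x j - phi i' x j) ^+ 2).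

Let mu i := \sum_x w x * f i x.

Let bmu : bounded_on mu.
Proof. by apply: bounded_on_sum => x; exact: bounded_onZ. Qed.

(** The factor 2 comes from symmetrization, [Num.sqrt 2] from Khintchine. *)
Definition rad_term i (y : T * {ffun 'I_p -> bool}) : R :=
  2 * Num.sqrt 2 * \sum_j (-1) ^+ y.2 j * phi i y.1 j.

Let brad y : bounded_on (fun i => rad_term i y).
Proof. by apply/bounded_onZ/bounded_on_sum => j; exact: bounded_onZ. Qed.

(** The law of a point paired with an independent uniform sign vector, so that the symmetrized mean
    is again an [iid_mean]. *)
Definition signed_weight (y : T * {ffun 'I_p -> bool}) : R := w y.1 * (2 ^+ p)^-1.

(** Twice the deviation is [(2 * mu i + xi i) + (-2 * f i x + xi i)], so its supremum splits. Jensen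
    moves the mean out of the first part; averaging over [x] then leaves a random sign before
    [2 * f i x], as on the left of [sign_contraction]. *)
Lemma symmetrization_step xi : bounded_on xi ->
  \sum_x w x * sup_on (fun i => mu i - f i x + xi i) <=
  \sum_y signed_weight y * sup_on (fun i => rad_term i y + xi i).
Proof.
move=> bxi.
pose S c x := sup_on (fun i => c * f i x + xi i).
have bS c x : bounded_on (fun i => c * f i x + xi i).
  by apply: bounded_onD => //; exact: bounded_onZ.
have step x : sup_on (fun i => mu i - f i x + xi i) <=
    ((\sum_y w y * S 2 y) + S (-2) x) / 2.
  apply: sup_on_le => i Ai; rewrite ler_pdivlMr//.
  have -> : (mu i - f i x + xi i) * 2 = (2 * mu i + xi i) + (-2 * f i x + xi i) by ring.
  apply: lerD; last exact: (sup_on_ge _ _ (bS _ _) Ai).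
  have -> : 2 * mu i + xi i = \sum_y w y * (2 * f i y + xi i).
    rewrite [RHS](eq_bigr (fun y => 2 * (w y * f i y) + w y * xi i)) => [|y _]; last by ring.
    by rewrite big_split /= -mulr_sumr -mulr_suml w1 mul1r.
  by apply: ler_sum => y _; apply: ler_wpM2l => //; exact: (sup_on_ge _ _ (bS _ _) Ai).
apply: le_trans (_ : _ <= \sum_x w x * ((S 2 x + S (-2) x) / 2)) _.
  apply: le_trans (_ : _ <= \sum_x w x * (((\sum_y w y * S 2 y) + S (-2) x) / 2)) _.
    by apply: ler_sum => x _; apply: ler_wpM2l.
  rewrite (eq_bigr (fun x => w x * ((\sum_y w y * S 2 y) / 2)
    + (w x * S (-2) x) / 2)) => [|x _]; last by ring.
  rewrite [leRHS](eq_bigr (fun x => (w x * S 2 x) / 2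
    + (w x * S (-2) x) / 2)) => [|x _]; last by ring.
  by rewrite !big_split /= -mulr_suml w1 mul1r -[X in _ <= X + _]mulr_suml.
rewrite -(pair_bigA _ (fun x s => signed_weight (x, s) * sup_on (fun i => rad_term i (x, s) + xi i))) /=.
apply: ler_sum => x _.
rewrite /signed_weight /=.
under [leRHS]eq_bigr do rewrite -mulrA.
rewrite -mulr_sumr; apply: ler_wpM2l => //; rewrite -mulr_sumr.
have := sign_contraction p (fun i => 2 * f i x) xi (fun j i => 2 * phi i x j).
have -> : (fun i => - (2 * f i x) + xi i) = (fun i => -2 * f i x + xi i).
  by apply/funext => i; rewrite mulNr.
move=> /(_ bxi) H; apply: le_trans (H _ _) _.
- by move=> j; exact: bounded_onZ.
- move=> i i' Ai Ai'; rewrite -mulrBr normrM (@ger0_norm _ 2)//.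
  rewrite [X in Num.sqrt X](eq_bigr (fun j => 2 ^+ 2 * (phi i x j - phi i' x j) ^+ 2)).
    by rewrite -mulr_sumr sqrtrM ?exprn_ge0// sqrtr_sqr (@ger0_norm _ 2)// ler_wpM2l// lip.
  by move=> j _; ring.
apply: le_sign_mean => s; apply: eq_ler; apply: eq_sup_on => i _; congr +%R.
rewrite /rad_term /= [2 * _]mulrC -mulrA; congr *%R; rewrite mulr_sumr.
by apply: eq_bigr => j _; ring.
Qed.

(** [xi] stores the other points: the head while the tail is symmetrized by induction, then the tail
    while [symmetrization_step] treats the head. *)
Lemma symmetrization n xi : bounded_on xi ->
  iid_mean w n (fun s => sup_on (fun i => \sum_(x <- s) (mu i - f i x) + xi i)) <=
  iid_mean signed_weight n
    (fun s => sup_on (fun i => \sum_(y <- s) rad_term i y + xi i)).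
Proof.
elim: n xi => [|n IH] xi bxi /=.
  by apply: eq_ler; apply: eq_sup_on => i _; rewrite !big_nil.
have bmf x : bounded_on (fun i => mu i - f i x).
  by apply: bounded_onD => //; exact: bounded_onN.
have v0 y : 0 <= signed_weight y by rewrite mulr_ge0// invr_ge0 exprn_ge0.
apply: le_trans (_ : _ <= \sum_x w x * iid_mean signed_weight n
   (fun s => sup_on (fun i => \sum_(y <- s) rad_term i y + (mu i - f i x + xi i)))) _.
  apply: ler_sum => x _; apply: ler_wpM2l => //.
  apply: le_trans (IH _ (bounded_onD _ _ (bmf x) bxi)); apply: eq_ler; apply: eq_iid_mean => s _.
  by apply: eq_sup_on => i _; rewrite big_cons; ring.
rewrite !iid_mean_lin; apply: le_iid_mean => // s _.
have bs : bounded_on (fun i => \sum_(y <- s) rad_term i y + xi i).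
  by apply: bounded_onD => //; exact: bounded_on_sum.
apply: le_trans (_ : _ <= \sum_x w x * sup_on (fun i => mu i - f i x +
     (\sum_(y <- s) rad_term i y + xi i))) _.
  apply: ler_sum => x _; apply: ler_wpM2l => //; apply: eq_ler; apply: eq_sup_on => i _; ring.
apply: le_trans (symmetrization_step _ bs) _.
apply: ler_sum => y _; apply: ler_wpM2l => //; apply: eq_ler; apply: eq_sup_on => i _.
by rewrite big_cons; ring.
Qed.

End Symmetrization.
End SupOn.

(** * Uniform deviation bound *)

Section Inequalities.
Context {R : realType}.

Lemma cauchy_schwarz_sum p (a b : 'I_p -> R) :
  `|\sum_j a j * b j| <= Num.sqrt (\sum_j a j ^+ 2) * Num.sqrt (\sum_j b j ^+ 2).
Proof.
set S := \sum_j a j * b j; set A2 := \sum_j a j ^+ 2; set B2 := \sum_j b j ^+ 2.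
have A0 : 0 <= A2 by apply: sumr_ge0 => j _; exact: sqr_ge0.
have B0 : 0 <= B2 by apply: sumr_ge0 => j _; exact: sqr_ge0.
suff SAB : S ^+ 2 <= A2 * B2.
  by rewrite -sqrtr_sqr -sqrtrM// ler_wsqrtr.
have disc t : 0 <= A2 - 2 * t * S + t ^+ 2 * B2.
  have -> : A2 - 2 * t * S + t ^+ 2 * B2 = \sum_j (a j - t * b j) ^+ 2.
    rewrite [RHS](eq_bigr (fun j => a j ^+ 2 - 2 * t * (a j * b j) + t ^+ 2 * b j ^+ 2)).
      by rewrite big_split sumrB /= -!mulr_sumr.
    by move=> j _; ring.
  by apply: sumr_ge0 => j _; exact: sqr_ge0.
have [B20|Bn0] := eqVneq B2 0.
  (* With [B2 = 0] the quadratic is affine in [t]; this [t] would make it negative unless [S]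
     vanishes. *)
  have := disc ((A2 + 1) / S); rewrite B20 !mulr0 addr0.
  have [->|S0] := eqVneq S 0; first by rewrite expr0n.
  by have -> : 2 * ((A2 + 1) / S) * S = 2 * (A2 + 1); [by field|lra].
have := disc (S / B2).
have -> : A2 - 2 * (S / B2) * S + (S / B2) ^+ 2 * B2 = (A2 * B2 - S ^+ 2) / B2 by field.
by rewrite pmulr_lge0 ?subr_ge0// invr_gt0 lt_neqAle eq_sym Bn0.
Qed.

Lemma ln_lipschitz (M a b : R) : expR (- M) <= a -> expR (- M) <= b ->
  `|ln a - ln b| <= expR M * `|a - b|.
Proof.
wlog ba : a b / b <= a => [H|] Ma Mb.
  have [ba|/ltW ab] := leP b a; first exact: H.
  by rewrite distrC [`|a - b|]distrC; exact: H.
have b0 : 0 < b := lt_le_trans (expR_gt0 _) Mb.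
have a0 : 0 < a := lt_le_trans b0 ba.
rewrite ger0_norm ?subr_ge0 ?ler_ln ?posrE// ger0_norm ?subr_ge0//.
rewrite -ln_div ?posrE//.
have -> : a / b = 1 + (a - b) / b by field; rewrite gt_eqF.
have d0 : 0 <= (a - b) / b by rewrite divr_ge0 ?subr_ge0// ltW.
apply: (@le_trans _ _ ((a - b) / b)); first by apply: le_ln1Dx; lra.
rewrite mulrC; apply: ler_wpM2r; first by rewrite subr_ge0.
by rewrite -[expR M]invrK -expRN lef_pV2 ?posrE ?expR_gt0.
Qed.

Lemma bernoulli_ineq n (e : R) : 0 <= e <= 1 -> 1 - n%:R * e <= (1 - e) ^+ n.
Proof.
move=> /andP[e0 e1]; elim: n => [|n IH]; first by rewrite mul0r subr0 expr0.
have n0 : (0 : R) <= n%:R by exact: ler0n.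
rewrite exprS -natr1; apply: le_trans (ler_wpM2l _ IH); last by lra.
by nra.
Qed.

End Inequalities.

Section UniformDeviation.
Context {R : realType} {I : Type} {T : finType} {p : nat}.
Variables (A : set I) (w : T -> R) (f : I -> T -> R) (phi : I -> T -> 'I_p -> R).
Hypothesis A0 : A !=set0.
Hypotheses (w0 : forall x, 0 <= w x) (w1 : \sum_x w x = 1).
Hypothesis bphi : forall x j, bounded_on A (fun i => phi i x j).
Hypothesis lip : forall x i i', A i -> A i' ->
  `|f i x - f i' x| <= Num.sqrt (\sum_j (phi i x j - phi i' x j) ^+ 2).
Variables (M eta : R) (n : nat).
Hypotheses (M0 : 0 < M) (eta01 : 0 < eta <= 1) (n0 : (0 < n)%N).
Hypothesis fM : forall i x, A i -> 0 <= f i x <= M.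

Definition rad_bound : R := iid_mean (signed_weight w) n
  (fun s => sup_on A (fun i => \sum_(y <- s) rad_term phi i y)).

Definition good_sample (s : seq T) :=
  forall i, A i -> \sum_x w x * f i x <= (\sum_(x <- s) f i x) / n%:R
    + (rad_bound / n%:R + M * Num.sqrt (ln eta^-1 / (2 * n%:R))).

(** McDiarmid is applied to the unnormalised supremum [Phi], whose mean symmetrization bounds by
    [rad_bound]; outside the tail event every sample is good. *)
Lemma uniform_deviation :
  1 - eta <= iid_mean w n (fun s => `[< good_sample s >]%:R).
Proof.
have n0R : (0 : R) < n%:R by rewrite ltr0n.
have /andP[eta0 eta1] := eta01.
have ln0 : 0 <= ln eta^-1 by rewrite ln_ge0// invr_ge1// unitfE gt_eqF.
have bf x : bounded_on A (fun i => f i x).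
  by exists M => i Ai; case/andP: (fM i x Ai) => ? ?; rewrite ger0_norm.
pose mu i := \sum_x w x * f i x.
pose Phi (s : seq T) := sup_on A (fun i => \sum_(x <- s) (mu i - f i x)).
have bs s : bounded_on A (fun i => \sum_(x <- s) (mu i - f i x)).
  apply: bounded_on_sum => x; apply: bounded_onD; last exact: bounded_onN.
  by apply: bounded_on_sum => y; exact: bounded_onZ.
(* The terms [mu i] cancel, so replacing [x] by [y] costs [f i y - f i x], at most [M]. *)
have bd : bounded_difference T M Phi.
  move=> s1 s2 x y; rewrite lerBlDr; apply: sup_on_le => // i Ai.
  have := sup_on_ge _ _ _ (bs (s1 ++ y :: s2)) Ai.
  have /andP[fx0 fxM] := fM i x Ai; have /andP[fy0 fyM] := fM i y Ai.
  rewrite -/(Phi _) /= !big_cat !big_cons /=; lra.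
have EPhi : iid_mean w n Phi <= rad_bound.
  have := symmetrization A A0 w f phi w0 w1 bf bphi lip n (fun=> 0) (bounded_on_cst A 0).
  rewrite /rad_bound /Phi.
  rewrite (eq_iid_mean _ _ _ Phi) => [|s _]; last by apply: eq_sup_on => i _; rewrite addr0.
  move=> /le_trans; apply; rewrite le_eqVlt; apply/orP; left; apply/eqP.
  by apply: eq_iid_mean => s _; apply: eq_sup_on => i _; rewrite addr0.
(* Chosen so that McDiarmid's tail at [n%:R * dev] is exactly [eta]. *)
pose dev := M * Num.sqrt (ln eta^-1 / (2 * n%:R)).
have dev0 : 0 <= dev by rewrite mulr_ge0 ?sqrtr_ge0// ltW.
have := mcdiarmid T w M (n%:R * dev) n Phi w0 w1 M0 (mulr_ge0 (ltW n0R) dev0) n0 bd.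
have -> : - (2 * (n%:R * dev) ^+ 2 / (n%:R * M ^+ 2)) = ln eta.
  rewrite /dev !exprMn sqr_sqrtr; last by rewrite divr_ge0// mulr_ge0// ltW.
  by rewrite lnV ?posrE//; field; rewrite !gt_eqF.
rewrite lnK ?posrE// => tail.
have -> : 1 - eta = iid_mean w n (fun=> 1) - eta by rewrite iid_mean_cst.
rewrite lerBlDr -lerBlDl -iid_meanB; apply: le_trans tail.
apply: le_iid_mean => // s sz.
case: asboolP => [_|bad]; first by rewrite subrr ler0n.
rewrite subr0; case: ltP => // le_dev; exfalso; apply: bad => i Ai; rewrite -/dev.
have := sup_on_ge _ _ _ (bs s) Ai; rewrite -/(Phi s) /= sumrB.
rewrite big_const_seq count_predT sz iter_addr_0 -[mu i *+ n]mulr_natl => PhiS.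
rewrite -/(mu i) -(ler_pM2l n0R).
have -> : n%:R * ((\sum_(x <- s) f i x) / n%:R + (rad_bound / n%:R + dev)) =
  \sum_(x <- s) f i x + rad_bound + n%:R * dev by field; rewrite gt_eqF.
lra.
Qed.

End UniformDeviation.

(** * Mixtures of experts *)

Section EsumFin.
Context {R : realType}.

Lemma esum_finpred (J : finType) (Q : pred J) (F : J -> R) :
  (forall j, 0 <= F j) ->
  \esum_(j in [set` Q]) (F j)%:E = (\sum_(j | Q j) F j)%:E.
Proof.
move=> F0; rewrite esum_fset//; last by move=> j _; rewrite lee_fin.
rewrite -(@bigfs _ _ _ _ (index_enum J) Q) ?index_enum_uniq ?sumEFin//.
by move=> j _; rewrite mem_index_enum.
Qed.

Lemma esum_finT (J : finType) (F : J -> R) : (forall j, 0 <= F j) ->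
  \esum_(j in [set: J]) (F j)%:E = (\sum_j F j)%:E.
Proof.
move=> F0; rewrite -(esum_finpred J xpredT F F0).
by congr esum; apply/seteqP; split.
Qed.

Lemma is_distr_fin (X : finType) (P : X -> R) :
  is_distr P <-> (forall x, 0 <= P x) /\ \sum_x P x = 1.
Proof.
rewrite /is_distr; split => -[P0]; rewrite esum_finT// => E.
  by split=> //; have [] := E.
by split=> //; rewrite E.
Qed.

Lemma Ex_fin (X : finType) (P f : X -> R) : (forall x, 0 <= P x * f x) ->
  Ex P f = (\sum_x P x * f x)%:E.
Proof. exact: esum_finT. Qed.

Lemma Ex_mixture (X : finType) p (lam : 'I_p -> R) (P : 'I_p -> X -> R) (f : X -> R) :
  (forall k, 0 <= lam k) -> (forall k x, 0 <= P k x) -> (forall x, 0 <= f x) ->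
  Ex (mixture lam P) f = (\sum_k lam k * \sum_x P k x * f x)%:E.
Proof.
move=> lam0 P0 f0; rewrite Ex_fin => [|x]; last first.
  by rewrite mulr_ge0// sumr_ge0// => k _; rewrite mulr_ge0.
congr EFin; under eq_bigr do rewrite mulr_suml.
rewrite exchange_big; apply: eq_bigr => k _; rewrite mulr_sumr.
by apply: eq_bigr => x _; rewrite mulrA.
Qed.

Lemma empirical_mean (X : finType) (s : seq X) (f : X -> R) :
  \sum_x empirical s x * f x = (\sum_(x <- s) f x) / (size s)%:R.
Proof.
rewrite [X in _ = X / _](_ : _ = \sum_x (count_mem x s)%:R * f x); last first.
  elim: s => [|y s IH].
    by rewrite big_nil big1// => x _; rewrite mul0r.
  rewrite big_cons IH [RHS](eq_bigr (fun x => (y == x)%:R * f x + (count_mem x s)%:R * f x)).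
    rewrite big_split /= [in RHS](bigD1 y)//= eqxx mul1r [X in _ = _ + X + _]big1 ?addr0// => x.
    by rewrite eq_sym => /negbTE ->; rewrite mul0r.
  by move=> x _; rewrite /= natrD mulrDl.
by rewrite mulr_suml; apply: eq_bigr => x _; rewrite /empirical mulrAC.
Qed.

Lemma sample_weight_ge0 (X : countType) (P : X -> R) (s : seq X) :
  (forall x, 0 <= P x) -> 0 <= sample_weight P s.
Proof. by move=> P0; apply: prodr_ge0 => x _. Qed.

(** The [p] samples have different sizes; sequences of bounded length house them in one finite type,
    where a product of sums can be distributed. *)
Lemma sum_bseq_tuple (X : finType) (N n : nat) (Q : pred (seq X)) (F : seq X -> R) :
  (n <= N)%N ->
  \sum_(s : N.-bseq X | (size s == n) && Q s) F s = \sum_(t : n.-tuple X | Q t) F t.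
Proof.
move=> nN.
have sz (t : n.-tuple X) : (size t <= N)%N by rewrite size_tuple.
rewrite (reindex_omap (fun t : n.-tuple X => Bseq (sz t)) (fun s : N.-bseq X => insub (val s))).
  apply: eq_bigl => t /=; rewrite size_tuple eqxx /= valK eqxx andbT //.
move=> s /andP[/eqP ss _]; case: insubP => [t _ E|]; last by rewrite ss eqxx.
by congr Some; apply/val_inj.
Qed.

End EsumFin.

(** * The log-loss of a gate: range, Lipschitz constant and Rademacher complexity *)

Section Gates.
Context {R : realType} {X : finType} {p : nat}.
Variables (pihat : 'I_p -> X -> R) (M : R).
Hypothesis p0 : (0 < p)%N.
Hypothesis pihat_distr : forall k, is_distr (pihat k).
Hypothesis pihat_gt0 : forall k x, 0 < pihat k x.
Hypothesis pihat_ln : forall k x, `|ln (pihat k x)| <= M.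

Definition lip_const : R := coinc_norm pihat * expR M.

Lemma expert_ge k x : expR (- M) <= pihat k x.
Proof.
rewrite -[leRHS]lnK ?posrE// ler_expR.
by have := pihat_ln k x; rewrite ler_norml => /andP[].
Qed.

Lemma expert_le1 k x : pihat k x <= 1.
Proof.
have [P0 P1] := (is_distr_fin _ _).1 (pihat_distr k).
by rewrite -P1 (bigD1 x)//= lerDl sumr_ge0.
Qed.

Lemma pi_g_bounds g x : is_gate g -> expR (- M) <= pi_g pihat g x <= 1.
Proof.
move=> [g01 g1]; apply/andP; split.
  rewrite -[leLHS]mul1r -(g1 x) mulr_suml; apply: ler_sum => k _.
  by apply: ler_wpM2l; [case/andP: (g01 x k)|exact: expert_ge].
rewrite -(g1 x); apply: ler_sum => k _; rewrite -[leRHS]mulr1.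
by apply: ler_wpM2l; [case/andP: (g01 x k)|exact: expert_le1].
Qed.

Lemma neg_ln_pi_g_bounds g x : is_gate g -> 0 <= - ln (pi_g pihat g x) <= M.
Proof.
move=> gg; have /andP[l u] := pi_g_bounds g x gg.
rewrite oppr_ge0 ln_le0//= lerNl -[leLHS]expRK ler_ln ?posrE ?expR_gt0//.
exact: lt_le_trans (expR_gt0 _) l.
Qed.

Lemma coinc_norm_ge x : Num.sqrt (\sum_k pihat k x ^+ 2) <= coinc_norm pihat.
Proof.
apply: ub_le_sup; last by exists x.
(* Expert values are at most 1, so every norm is at most the root of [p] and the [sup] is
   genuine. *)
exists (Num.sqrt p%:R) => _ [y _ <-]; apply: ler_wsqrtr.
rewrite -[p in leRHS]card_ord -sum1_card natr_sum; apply: ler_sum => k _.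
by rewrite expr_le1// ?expert_le1// ltW.
Qed.

(** The logarithm contributes [expR M], since [pi_g] stays above [expR (- M)]; Cauchy-Schwarz
    against the expert vector contributes the coincidence norm. *)
Lemma neg_ln_pi_g_lipschitz x g g' : is_gate g -> is_gate g' ->
  `|- ln (pi_g pihat g x) - - ln (pi_g pihat g' x)| <=
  Num.sqrt (\sum_j (lip_const * g x j - lip_const * g' x j) ^+ 2).
Proof.
move=> gg gg'; set L := lip_const.
have C0 : 0 <= coinc_norm pihat := le_trans (sqrtr_ge0 _) (coinc_norm_ge x).
have L0 : 0 <= L by rewrite mulr_ge0// expR_ge0.
rewrite [X in Num.sqrt X](eq_bigr (fun j => L ^+ 2 * (g x j - g' x j) ^+ 2)); last by move=> j _; ring.
rewrite -mulr_sumr sqrtrM ?exprn_ge0// sqrtr_sqr (@ger0_norm _ L)//.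
have /andP[l _] := pi_g_bounds g x gg; have /andP[l' _] := pi_g_bounds g' x gg'.
rewrite -opprD normrN; apply: le_trans (ln_lipschitz _ _ _ l l') _.
rewrite /L /lip_const [coinc_norm _ * _]mulrC -mulrA; apply: ler_wpM2l; first exact: expR_ge0.
rewrite /pi_g -sumrB.
under eq_bigr do rewrite -mulrBl.
apply: le_trans (cauchy_schwarz_sum _ _ _) _.
rewrite mulrC; apply: ler_wpM2r; first exact: sqrtr_ge0.
exact: coinc_norm_ge.
Qed.

Lemma G1_nonempty : G1 pihat !=set0.
Proof.
(* The gate that always selects the first expert, for which [pi_g] is that expert's distribution. *)
exists (fun _ k => (k == Ordinal p0)%:R); split.
  split=> [x k|x]; first by case: eqP; rewrite ?lexx ?ler01.
  by rewrite (bigD1 (Ordinal p0))// eqxx /= big1 ?addr0// => k /negbTE ->.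
rewrite -(pihat_distr (Ordinal p0)).2; apply: eq_esum => x _; congr EFin.
rewrite /pi_g (bigD1 (Ordinal p0))// eqxx /= mul1r big1 ?addr0// => k /negbTE ->.
by rewrite mul0r.
Qed.

Definition rademacher_real (P : X -> R) n : R :=
  \sum_(xs : n.-tuple X) sample_weight P xs * (n%:R^-1 * ((2 ^+ (n * p))%:R^-1 *
     \sum_(sg : {ffun 'I_n * 'I_p -> bool})
       sup_on (G1 pihat) (fun g => \sum_(i < n) \sum_(j < p) (-1) ^+ sg (i, j) * g (tnth xs i) j))).

Lemma gate_bounded x j : bounded_on (G1 pihat) (fun g => g x j).
Proof.
by exists 1 => g [[g01 _] _]; case/andP: (g01 x j) => ? ?; rewrite ger0_norm.
Qed.

Lemma gate_sum_bounded n (xs : n.-tuple X) (sg : {ffun 'I_n * 'I_p -> bool}) :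
  bounded_on (G1 pihat) (fun g => \sum_(i < n) \sum_(j < p) (-1) ^+ sg (i, j) * g (tnth xs i) j).
Proof.
by do 2!(apply: bounded_on_sum => ?); apply: bounded_onZ; exact: gate_bounded.
Qed.

(** Each supremum dominates the value at a fixed gate, and those values cancel under negation of all
    signs. Nonnegativity turns the extended sum in [rademacher] into a finite real one. *)
Let sum_sup_ge0 n (xs : n.-tuple X) : 0 <= \sum_(sg : {ffun 'I_n * 'I_p -> bool})
   sup_on (G1 pihat) (fun g => \sum_(i < n) \sum_(j < p) (-1) ^+ sg (i, j) * g (tnth xs i) j).
Proof.
have [g Gg] := G1_nonempty.
apply: le_trans (_ : \sum_(sg : {ffun 'I_n * 'I_p -> bool})
   \sum_(i < n) \sum_(j < p) (-1) ^+ sg (i, j) * g (tnth xs i) j <= _); last first.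
  apply: ler_sum => sg _.
  exact: (sup_on_ge _ _ _ (gate_sum_bounded n xs sg) Gg).
pose neg (sg : {ffun 'I_n * 'I_p -> bool}) := [ffun ij => ~~ sg ij].
have negK : involutive neg by move=> sg; apply/ffunP => j; rewrite !ffunE negbK.
set S := \sum_sg _; suff : S = - S by lra.
rewrite {1}/S (reindex_inj (can_inj negK)) -sumrN; apply: eq_bigr => sg _.
rewrite -sumrN; apply: eq_bigr => i _; rewrite -sumrN; apply: eq_bigr => j _.
by rewrite /neg ffunE; case: (sg _); rewrite /= ?expr0 ?expr1; ring.
Qed.

Lemma rademacherE P n : (forall x, 0 <= P x) ->
  rademacher pihat P n = (rademacher_real P n)%:E.
Proof.
move=> P0; rewrite /rademacher_real -esum_finT => [|xs].
  by apply: eq_esum => xs _; rewrite EFinM.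
apply: mulr_ge0; first exact: sample_weight_ge0.
by rewrite mulr_ge0 ?invr_ge0// mulr_ge0 ?invr_ge0.
Qed.

(** A sequence of points with sign vectors is a sample together with a sign matrix; after this
    reindexing the constants leave the supremum by homogeneity. *)
Lemma rad_bound_le P n : (forall x, 0 <= P x) -> (0 < n)%N ->
  0 <= lip_const ->
  rad_bound (G1 pihat) P (fun g x j => lip_const * g x j) n / n%:R <=
  2 * Num.sqrt 2 * coinc_norm pihat * expR M * rademacher_real P n.
Proof.
move=> P0 n0; set L := lip_const => L0.
have n0R : (0 : R) < n%:R by rewrite ltr0n.
rewrite ler_pdivrMr// /rad_bound -iid_mean_tuple.
(* [h] attaches to each sample point its row of the sign matrix; it is kept abstract and used only
   through [hE]. *)
have [h hE] : {h : n.-tuple X * {ffun 'I_n * 'I_p -> bool} -> n.-tuple (X * {ffun 'I_p -> bool}) |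
    forall z i, tnth (h z) i = (tnth z.1 i, [ffun j => z.2 (i, j)])}.
  by exists (fun z : n.-tuple X * {ffun 'I_n * 'I_p -> bool} =>
    [tuple (tnth z.1 i, [ffun j => z.2 (i, j)]) | i < n]) => z i; rewrite tnth_mktuple.
rewrite (reindex h); last first.
  exists (fun t : n.-tuple (X * {ffun 'I_p -> bool}) =>
     ([tuple (tnth t i).1 | i < n], [ffun ij => (tnth t ij.1).2 ij.2])) => [[xs sg]|t] _ /=.
    congr pair.
      by apply: eq_from_tnth => i; rewrite tnth_mktuple hE.
    by apply/ffunP => -[i j]; rewrite ffunE hE ffunE.
  apply: eq_from_tnth => i; rewrite hE tnth_mktuple /=.
  case E: (tnth t i) => [x s] /=; congr pair.
  by apply/ffunP => j; rewrite !ffunE /= E.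
rewrite /rademacher_real mulr_sumr mulr_suml.
pose G xs sg := (\prod_(y <- h (xs, sg)) signed_weight P y) *
  sup_on (G1 pihat) (fun g => \sum_(y <- h (xs, sg)) rad_term (fun g x j => L * g x j) g y).
rewrite (eq_bigr (fun z => G z.1 z.2)) => [|[xs sg] _ //].
rewrite -(pair_bigA _ G) /=.
apply: ler_sum => xs _.
have -> : 2 * Num.sqrt 2 * coinc_norm pihat * expR M = 2 * Num.sqrt 2 * L.
  by rewrite /L /lip_const; ring.
set S := \sum_sg sup_on _ _.
have -> : 2 * Num.sqrt 2 * L * (sample_weight P xs * (n%:R^-1 * ((2 ^+ (n * p))%:R^-1 * S))) * n%:R
   = sample_weight P xs * ((2 ^+ (n * p))^-1 * (2 * Num.sqrt 2 * L * S)).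
  by rewrite natrX; field; rewrite expf_neq0//= gt_eqF.
rewrite /S !mulr_sumr; apply: ler_sum => sg _; rewrite /G.
have -> : \prod_(y <- h (xs, sg)) signed_weight P y = sample_weight P xs * (2 ^+ (n * p))^-1.
  rewrite /sample_weight !big_tuple /signed_weight.
  under eq_bigr do rewrite hE /=.
  by rewrite big_split /= big_const_ord iter_mulr_1 mulnC exprM exprVn.
rewrite -mulrA; apply: ler_wpM2l; first exact: sample_weight_ge0.
apply: ler_wpM2l; first by rewrite invr_ge0 exprn_ge0.
apply: le_trans (sup_onZ_le _ G1_nonempty _ _ _ (gate_sum_bounded n xs sg)); last first.
  by rewrite mulr_ge0// mulr_ge0// sqrtr_ge0.
rewrite le_eqVlt; apply/orP; left; apply/eqP; apply: eq_sup_on => g _.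
rewrite big_tuple mulr_sumr; apply: eq_bigr => i _.
rewrite hE /rad_term /= -[RHS]mulrA; congr *%R.
rewrite mulr_sumr; apply: eq_bigr => j _; rewrite ffunE; ring.
Qed.

End Gates.

(** * The bound on a finite space: one sample, then all samples and mixtures *)

Section FiniteSpace.
Context {R : realType} {X : finType} {p : nat}.
Variables (P pihat : 'I_p -> X -> R) (M : R) (m : 'I_p -> nat) (delta : R).
Hypotheses (p0 : (0 < p)%N) (P_distr : forall k, is_distr (P k)).
Hypothesis pihat_distr : forall k, is_distr (pihat k).
Hypotheses (M0 : 0 < M) (pihat_gt0 : forall k x, 0 < pihat k x).
Hypothesis pihat_ln : forall k x, `|ln (pihat k x)| <= M.
Hypotheses (m0 : forall k, (0 < m k)%N) (delta01 : 0 < delta < 1).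

Let loss (g : X -> 'I_p -> R) x : R := - ln (pi_g pihat g x).
Let L : R := lip_const pihat M.
Let phi (g : X -> 'I_p -> R) x j : R := L * g x j.
(** The failure probability allowed to each of the [p] samples. *)
Let eta : R := delta / p%:R.
Let good k (s : seq X) :=
  good_sample (G1 pihat) (P k) loss phi M eta (m k) s.

Let p0R : (0 : R) < p%:R. Proof. by rewrite ltr0n. Qed.

Let eta01 : 0 < eta <= 1.
Proof.
have /andP[d0 d1] := delta01; rewrite divr_gt0//= ler_pdivrMr// mul1r.
by apply: le_trans (ltW d1) _; rewrite ler1n.
Qed.

Let P0 k x : 0 <= P k x. Proof. by have [] := P_distr k. Qed.

Let P1 k : \sum_x P k x = 1.
Proof. by have [] := (is_distr_fin X (P k)).1 (P_distr k). Qed.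

Let loss_bounds g x : G1 pihat g -> 0 <= loss g x <= M.
Proof. by move=> [gg _]; exact: neg_ln_pi_g_bounds. Qed.

Let L0 : 0 <= L.
Proof.
rewrite mulr_ge0 ?expR_ge0//; have [x _|X0] := pickP X.
  exact: le_trans (sqrtr_ge0 _) (coinc_norm_ge _ pihat_distr pihat_gt0 x).
by have := P1 (Ordinal p0); rewrite big_pred0// => /eqP; rewrite eq_sym oner_eq0.
Qed.

Let loss_lip x g g' : G1 pihat g -> G1 pihat g' ->
  `|loss g x - loss g' x| <= Num.sqrt (\sum_j (phi g x j - phi g' x j) ^+ 2).
Proof. by move=> [gg _] [gg' _]; exact: neg_ln_pi_g_lipschitz. Qed.

Let phi_bounded x j : bounded_on (G1 pihat) (fun g => phi g x j).
Proof. by apply: bounded_onZ; exact: gate_bounded. Qed.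

Lemma good_sample_proba k :
  1 - eta <= \sum_(t : (m k).-tuple X | `[< good k t >]) sample_weight (P k) t.
Proof.
have := uniform_deviation (G1 pihat) (P k) loss phi (G1_nonempty pihat p0 pihat_distr)
  (P0 k) (P1 k) phi_bounded loss_lip M eta (m k) M0 eta01 (m0 k) loss_bounds.
move=> /le_trans; apply; rewrite -iid_mean_tuple [leRHS]big_mkcond; apply: ler_sum => t _.
by rewrite /sample_weight; case: ifP => _; rewrite ?mulr1 ?mulr0.
Qed.

(** No randomness remains: the bounds for the single [k], weighted by [lam k] and summed, give every
    mixture at once. *)
Lemma good_samples_bound (S : {ffun 'I_p -> seq X}) :
  (forall k, size (S k) = m k) -> (forall k, good k (S k)) ->
  forall g, G1 pihat g -> forall lam : 'I_p -> R, simplex lam ->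
  (Ex (mixture lam P) (fun x => (- ln (pi_g pihat g x))%R)
   <= Ex (mixture lam (fun k => empirical (S k)))
         (fun x => (- ln (pi_g pihat g x))%R)
      + \sum_(k < p)
          ((lam k)%:E *
           ((2 * Num.sqrt 2 * coinc_norm pihat * expR M)%R%:E
              * rademacher pihat (P k) (m k)
            + (M * Num.sqrt (ln (p%:R / delta) / (2 * (m k)%:R)))%R%:E)))%E.
Proof.
move=> sz goodS g Gg lam [lam0 _].
have loss0 x : 0 <= loss g x by case/andP: (loss_bounds g x Gg).
rewrite !Ex_mixture// => [|k x]; last by rewrite /empirical divr_ge0.
have -> : (\sum_(k < p) ((lam k)%:E *
           ((2 * Num.sqrt 2 * coinc_norm pihat * expR M)%R%:E
              * rademacher pihat (P k) (m k)
            + (M * Num.sqrt (ln (p%:R / delta) / (2 * (m k)%:R)))%R%:E)))%E =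
   (\sum_(k < p) lam k * (2 * Num.sqrt 2 * coinc_norm pihat * expR M
      * rademacher_real pihat (P k) (m k)
      + M * Num.sqrt (ln (p%:R / delta) / (2 * (m k)%:R))))%:E.
  rewrite -sumEFin; apply: eq_bigr => k _.
  by rewrite rademacherE// -?EFinM -?EFinD.
rewrite -EFinD lee_fin -big_split /=; apply: ler_sum => k _.
rewrite -mulrDr; apply: ler_wpM2l => //.
have := goodS k g Gg; rewrite empirical_mean sz invf_div => /le_trans; apply.
rewrite lerD2l lerD2r.
exact: rad_bound_le.
Qed.

Lemma generalization_bound_finite :
  (\esum_(S in [set S : {ffun 'I_p -> seq X} |
       (forall k, size (S k) = m k) /\
       (forall g, G1 pihat g -> forall lam : 'I_p -> R, simplex lam ->
          (Ex (mixture lam P) (fun x => (- ln (pi_g pihat g x))%R)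
           <= Ex (mixture lam (fun k => empirical (S k)))
                 (fun x => (- ln (pi_g pihat g x))%R)
              + \sum_(k < p)
                  ((lam k)%:E *
                   ((2 * Num.sqrt 2 * coinc_norm pihat * expR M)%R%:E
                      * rademacher pihat (P k) (m k)
                    + (M * Num.sqrt (ln (p%:R / delta) / (2 * (m k)%:R)))%R%:E)))%E)])
     (\prod_(k < p) sample_weight (P k) (S k))%:E
   >= (1 - delta)%:E)%E.
Proof.
pose N := \max_k m k.
pose Q k (s : N.-bseq X) := (size s == m k) && `[< good k s >].
pose e (f : {ffun 'I_p -> N.-bseq X}) : {ffun 'I_p -> seq X} := [ffun k => val (f k)].
have e_inj : set_inj [set` family Q] e.
  move=> f f' _ _ /ffunP E; apply/ffunP => k; apply/val_inj.
  by have := E k; rewrite !ffunE.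
have w0 k s : 0 <= sample_weight (P k) s by exact: sample_weight_ge0.
(* For a lower bound a finite part of the event suffices: the families whose samples are all good
   and of the right size. *)
apply: esum_ge; exists (e @` [set` family Q]).
  split; first exact/finite_image/finite_finset.
  move=> _ [f /familyP Qf <-]; have sz k : size (e f k) = m k.
    by rewrite ffunE; have /andP[/eqP] := Qf k.
  split=> //; apply: good_samples_bound => // k.
  by rewrite ffunE; have /andP[_ /asboolP] := Qf k.
rewrite -esum_fset; last 2 first.
- exact/finite_image/finite_finset.
- by move=> S _; rewrite lee_fin prodr_ge0.
rewrite esum_image// esum_finpred => [|f]; last by rewrite prodr_ge0.
rewrite lee_fin.
rewrite (eq_bigr (fun f : {ffun 'I_p -> N.-bseq X} => \prod_k sample_weight (P k) (f k))); last first.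
  by move=> f _; apply: eq_bigr => k _; rewrite ffunE.
(* Independence: the mass of these families factors into the probabilities of the single good
   events. *)
rewrite -(bigA_distr_big_dep Q (fun k s => sample_weight (P k) s)).
have /andP[eta0 eta1] := eta01.
have -> : 1 - delta = 1 - p%:R * eta by rewrite /eta; field; rewrite gt_eqF.
apply: le_trans (bernoulli_ineq p eta _) _; first by rewrite ltW.
rewrite -[leLHS](_ : \prod_(k < p) (1 - eta) = _); last by rewrite prodr_const card_ord.
apply: ler_prod => k _; rewrite subr_ge0 eta1 /=.
apply: le_trans (good_sample_proba k) _.
rewrite -(sum_bseq_tuple X N (m k) (fun s => `[< good k s >]) (sample_weight (P k)))//.
exact: leq_bigmax.
Qed.

End FiniteSpace.

(** * Reduction of the countable space to a finite one *)

Section FiniteSupport.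
Context {R : realType} {X : countType}.

(** An infinite space would hold [n] points of total mass at least [n%:R * c], exceeding 1 for large
    [n]. *)
Lemma finite_of_mass_ge (P : X -> R) (c : R) : is_distr P -> 0 < c ->
  (forall x, c <= P x) -> finite_set [set: X].
Proof.
move=> [P0 P1] c0 cP; apply: contrapT => infX.
have [n] : exists n : nat, 1 < n%:R * c.
  exists (Num.truncn c^-1).+1; rewrite -ltr_pdivrMr// mul1r.
  by rewrite truncnS_gt.
move=> nc; have [B _] := infinite_set_fset n infX; set r := finmap.enum_fset B => nB.
have r_uniq : uniq r by exact: finmap.fset_uniq.
have : ((\sum_(x <- r) P x)%:E <= 1)%E.
  rewrite -P1; apply: esum_ge; exists [set` r]; first by split => //; exact: finite_seq.
  by rewrite -fsbig_seq// -sumEFin.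
apply/negP; rewrite -ltNge lte_fin; apply: lt_le_trans nc _.
apply: (@le_trans _ _ (\sum_(x <- r) c)); last by apply: ler_sum.
rewrite big_const_seq count_predT iter_addr_0 -[leRHS]mulr_natl.
by apply: ler_wpM2r; [exact: ltW|rewrite ler_nat].
Qed.

End FiniteSupport.

Theorem mainTheorem11 (R : realType) (X : countType) (p : nat)
  (P : 'I_p -> X -> R) (pihat : 'I_p -> X -> R) (M : R) (m : 'I_p -> nat)
  (delta : R) :
  (0 < p)%N ->
  (forall k, is_distr (P k)) ->
  (forall k, is_distr (pihat k)) ->
  0 < M ->
  (forall k x, 0 < pihat k x) ->
  (forall k x, `|ln (pihat k x)| <= M) ->
  (forall k, (0 < m k)%N) ->
  0 < delta < 1 ->
  (\esum_(S in [set S : {ffun 'I_p -> seq X} |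
       (forall k, size (S k) = m k) /\
       (forall g, G1 pihat g -> forall lam : 'I_p -> R, simplex lam ->
          (Ex (mixture lam P) (fun x => (- ln (pi_g pihat g x))%R)
           <= Ex (mixture lam (fun k => empirical (S k)))
                 (fun x => (- ln (pi_g pihat g x))%R)
              + \sum_(k < p)
                  ((lam k)%:E *
                   ((2 * Num.sqrt 2 * coinc_norm pihat * expR M)%R%:E
                      * rademacher pihat (P k) (m k)
                    + (M * Num.sqrt (ln (p%:R / delta) / (2 * (m k)%:R)))%R%:E)))%E)])
     (\prod_(k < p) sample_weight (P k) (S k))%:E
   >= (1 - delta)%:E)%E.
Proof.
move=> p0 P_distr pihat_distr M0 pihat_gt0 pihat_ln m0 delta01.
have finX : finite_set [set: X].
  apply: (finite_of_mass_ge (pihat (Ordinal p0)) (expR (- M))) => // [|x].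
    exact: expR_gt0.
  rewrite -[leRHS]lnK ?posrE// ler_expR.
  by have := pihat_ln (Ordinal p0) x; rewrite ler_norml => /andP[].
have /finite_seqP[s sP] := finX.
have enumP : Finite.axiom (undup s).
  move=> x; rewrite count_uniq_mem ?undup_uniq// mem_undup.
  by have : [set: X] x by []; rewrite sP /= => ->.
pose finX_mixin := fintype.isFinite.Build X enumP.
(* The finite structure is put on [X] itself, so the finite statement is convertible to the goal. *)
pose X' : finType := HB.pack X finX_mixin.
exact: (@generalization_bound_finite R X' p P pihat M m delta).
Qed.
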